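(* Let $p,q$ be positive integers, let $(\overline{M},\overline{g},J)$ be a locally metallic Riemannian manifold with $J^2=pJ+qI$ (a locally Golden Riemannian manifold if $p=q=1$), and let $M$ be a hemi-slant submanifold of $\overline{M}$ with $TM=D^{\theta}\oplus D^{\perp}$. Then the anti-invariant distribution $D^{\perp}$ is integrable if and only if $$(\nabla_ZT)W=(\nabla_WT)Z$$ for any $Z,W\in\Gamma(D^{\perp})$.
   Context: A metallic Riemannian manifold $(\overline{M},\overline{g},J)$ is a Riemannian manifold $(\overline{M},\overline{g})$ with a $(1,1)$-tensor field $J$ such that $J^2=pJ+qI$ for some positive integers $p,q$ ($I$ the identity) and $\overline{g}(JX,Y)=\overline{g}(X,JY)$ for all vector fields $X,Y$; it is a Golden Riemannian manifold if $p=q=1$. It is locally metallic (locally Golden) if $\overline{\nabla}J=0$, where $\overline{\nabla}$ is the Levi-Civita connection of $\overline{g}$. $M$ is an isometrically immersed submanifold of $\overline{M}$, $\dim M<\dim\overline{M}$, with normal bundle $T^{\perp}M$ and Levi-Civita connection $\nabla$ of the induced metric. For $X\in\Gamma(TM)$ write $JX=TX+NX$ with $TX$ tangent and $NX$ normal to $M$; and $(\nabla_XT)Y=\nabla_XTY-T(\nabla_XY)$ for $X,Y\in\Gamma(TM)$. A differentiable distribution $D$ on $M$ is slant if the angle $\theta_D$ between $JX_x$ and the vector subspace $D_x$ is constant, for all $x\in M$ and all nonzero $X_x\in D_x$; $\theta_D$ is the slant angle. $M$ is a hemi-slant submanifold if there exist two orthogonal distributions $D^{\theta}$ and $D^{\perp}$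 on $M$ such that: (1) $TM=D^{\theta}\oplus D^{\perp}$ (orthogonal direct sum); (2) $D^{\theta}$ is slant with angle $\theta\in[0,\frac{\pi}{2}]$; (3) $D^{\perp}$ is anti-invariant, i.e. $J(D^{\perp})\subseteq T^{\perp}M$.
   Formalization: The formal theorem assumes in addition that the slant angle θ is not π/2; for θ = π/2 one can have T = 0 with a non-integrable D^⊥ (a contact distribution in a flat anti-invariant R^3 in R^6), so the equivalence fails. *)

(* Defs.v *)
From HB Require Import structures.
From mathcomp Require Import all_boot all_order all_algebra.
From mathcomp Require Import all_classical all_reals all_analysis.
Import Order.TTheory GRing.Theory Num.Theory numFieldNormedType.Exports.

Set Implicit Arguments.
Unset Strict Implicit.
Unset Printing Implicit Defensive.

Local Open Scope classical_set_scope.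
Local Open Scope ring_scope.

Fixpoint Ck_on (R : realType) (V W : normedModType R) (k : nat)
    (U : set V) (f : V -> W) : Prop :=
  match k with
  | 0 => forall x, U x -> continuous_at x f
  | k'.+1 => (forall x, U x -> differentiable f x) /\
             (forall v : V, Ck_on k' U (fun x => 'D_v f x))
  end.

Definition Cinfty_on (R : realType) (V W : normedModType R)
    (U : set V) (f : V -> W) : Prop := forall k, Ck_on k U f.

(* A chart is a homeomorphism between an open set of M and an open set of
   R^n; outside these sets the two maps take arbitrary values. *)
Record chart (R : realType) (n : nat) (M : topologicalType) := Chart {
  chart_dom : set M;
  chart_cod : set 'rV[R]_n;
  chart_map : M -> 'rV[R]_n;
  chart_inv : 'rV[R]_n -> M;
  chart_dom_open : open chart_dom;
  chart_cod_open : open chart_cod;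
  chart_map_cod : forall x, chart_dom x -> chart_cod (chart_map x);
  chart_inv_dom : forall y, chart_cod y -> chart_dom (chart_inv y);
  chart_mapK : forall x, chart_dom x -> chart_inv (chart_map x) = x;
  chart_invK : forall y, chart_cod y -> chart_map (chart_inv y) = y;
  chart_map_continuous : {within chart_dom, continuous chart_map};
  chart_inv_continuous : {within chart_cod, continuous chart_inv}
}.

Record manifold (R : realType) (n : nat) := Manifold {
  points :> topologicalType;
  atlas : set (chart R n points);
  manifold_hausdorff : hausdorff_space points;
  manifold_second_countable : @second_countable points;
  atlas_cover : forall x, exists2 c, atlas c & chart_dom c x;
  atlas_compatible : forall c d, atlas c -> atlas d ->
    Cinfty_on (chart_cod c `&` chart_inv c @^-1` chart_dom d)
      (chart_map d \o chart_inv c)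
}.

Definition smooth_on (R : realType) (n : nat) (M : manifold R n)
    (U : set M) (h : M -> R) : Prop :=
  forall c, atlas c ->
    Cinfty_on (W := R^o) (chart_cod c `&` chart_inv c @^-1` U)
      (h \o chart_inv c).

Definition smooth_fun (R : realType) (n : nat) (M : manifold R n)
    (h : M -> R) : Prop := smooth_on setT h.

Definition smooth_map (R : realType) (m n : nat)
    (M : manifold R m) (N : manifold R n) (f : M -> N) : Prop :=
  continuous f /\
  forall c d, atlas c -> atlas d ->
    Cinfty_on (chart_cod c `&` chart_inv c @^-1` (f @^-1` chart_dom d))
      (chart_map d \o f \o chart_inv c).

(* Tangent vectors at x are the derivations at x of the algebra of smooth
   functions.  To get one ambient vector space for all the tangent spaces of
   M, a tangent vector is encoded as a functional on all functions M -> R,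
   with value 0 on the functions that are not smooth; thus two tangent vectors
   are equal as soon as they agree on smooth functions. *)
Definition tvec (R : realType) (n : nat) (M : manifold R n) : lmodType R :=
  (M -> R) -> R^o.

Record tangent (R : realType) (n : nat) (M : manifold R n)
    (x : M) (v : tvec M) : Prop := Tangent {
  tangentD : forall h k, smooth_fun h -> smooth_fun k ->
    v (fun y => h y + k y) = v h + v k;
  tangentZ : forall (a : R) h, smooth_fun h ->
    v (fun y => a * h y) = a * v h;
  tangentM : forall h k, smooth_fun h -> smooth_fun k ->
    v (fun y => h y * k y) = v h * k x + h x * v k;
  tangent_nonsmooth : forall h, ~ smooth_fun h -> v h = 0
}.

Definition differential (R : realType) (m n : nat)
    (M : manifold R m) (N : manifold R n) (f : M -> N)
    (v : tvec M) : tvec N :=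
  fun h => if `[< smooth_fun h >] then v (h \o f) else 0.

Definition immersion (R : realType) (m n : nat)
    (M : manifold R m) (N : manifold R n) (f : M -> N) : Prop :=
  smooth_map f /\
  forall x v, tangent x v -> differential f v = 0 -> v = 0.

Definition smooth_field_on (R : realType) (n : nat) (M : manifold R n)
    (U : set M) (X : M -> tvec M) : Prop :=
  (forall x, U x -> tangent x (X x)) /\
  (forall h, smooth_fun h -> smooth_on U (fun x => X x h)).

Definition smooth_field (R : realType) (n : nat) (M : manifold R n)
    (X : M -> tvec M) : Prop := smooth_field_on setT X.

Definition lie_bracket (R : realType) (n : nat) (M : manifold R n)
    (X Y : M -> tvec M) : M -> tvec M :=
  fun x h => X x (fun y => Y y h) - Y x (fun y => X y h).

(* Tensors are only constrained on tangent vectors, and connections only on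
   smooth vector fields. *)

Record riemannian (R : realType) (n : nat) (M : manifold R n)
    (g : M -> tvec M -> tvec M -> R) : Prop := Riemannian {
  metricC : forall x u v, tangent x u -> tangent x v -> g x u v = g x v u;
  metric_linear : forall x (a : R) u v w,
    tangent x u -> tangent x v -> tangent x w ->
    g x (a *: u + v) w = a * g x u w + g x v w;
  metric_gt0 : forall x v, tangent x v -> v <> 0 -> 0 < g x v v;
  metric_smooth : forall X Y, smooth_field X -> smooth_field Y ->
    smooth_fun (fun x => g x (X x) (Y x))
}.

Record connection (R : realType) (n : nat) (M : manifold R n)
    (nabla : (M -> tvec M) -> (M -> tvec M) -> (M -> tvec M)) : Prop :=
  Connection {
  connection_smooth : forall X Y, smooth_field X -> smooth_field Y ->
    smooth_field (nabla X Y);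
  connectionDl : forall X Y Z,
    smooth_field X -> smooth_field Y -> smooth_field Z ->
    nabla (fun x => X x + Y x) Z = fun x => nabla X Z x + nabla Y Z x;
  connectionMl : forall (h : M -> R) X Y,
    smooth_fun h -> smooth_field X -> smooth_field Y ->
    nabla (fun x => h x *: X x) Y = fun x => h x *: nabla X Y x;
  connectionDr : forall X Y Z,
    smooth_field X -> smooth_field Y -> smooth_field Z ->
    nabla X (fun x => Y x + Z x) = fun x => nabla X Y x + nabla X Z x;
  connectionMr : forall (h : M -> R) X Y,
    smooth_fun h -> smooth_field X -> smooth_field Y ->
    nabla X (fun x => h x *: Y x) =
      fun x => (X x h : R) *: Y x + h x *: nabla X Y x
}.

Record levi_civita (R : realType) (n : nat) (M : manifold R n)
    (g : M -> tvec M -> tvec M -> R)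
    (nabla : (M -> tvec M) -> (M -> tvec M) -> (M -> tvec M)) : Prop :=
  LeviCivita {
  levi_civita_connection : connection nabla;
  levi_civita_torsion_free : forall X Y, smooth_field X -> smooth_field Y ->
    (fun x => nabla X Y x - nabla Y X x) = lie_bracket X Y;
  levi_civita_metric : forall X Y Z,
    smooth_field X -> smooth_field Y -> smooth_field Z ->
    forall x, X x (fun y => g y (Y y) (Z y)) =
      g x (nabla X Y x) (Z x) + g x (Y x) (nabla X Z x)
}.

Record metallic (R : realType) (n : nat) (M : manifold R n) (p q : nat)
    (g : M -> tvec M -> tvec M -> R) (J : M -> tvec M -> tvec M) : Prop :=
  Metallic {
  metallic_metric : riemannian g;
  metallic_tangent : forall x v, tangent x v -> tangent x (J x v);
  metallic_linear : forall x (a : R) u v, tangent x u -> tangent x v ->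
    J x (a *: u + v) = a *: J x u + J x v;
  metallic_smooth : forall X, smooth_field X ->
    smooth_field (fun x => J x (X x));
  metallic_sqr : forall x v, tangent x v ->
    J x (J x v) = (p%:R : R) *: J x v + (q%:R : R) *: v;
  metallic_self_adjoint : forall x u v, tangent x u -> tangent x v ->
    g x (J x u) v = g x u (J x v)
}.

Definition parallel (R : realType) (n : nat) (M : manifold R n)
    (nabla : (M -> tvec M) -> (M -> tvec M) -> (M -> tvec M))
    (J : M -> tvec M -> tvec M) : Prop :=
  forall X Y, smooth_field X -> smooth_field Y ->
    nabla X (fun x => J x (Y x)) = fun x => J x (nabla X Y x).

Definition induced_metric (R : realType) (m n : nat)
    (M : manifold R m) (N : manifold R n) (f : M -> N)
    (g : N -> tvec N -> tvec N -> R) : M -> tvec M -> tvec M -> R :=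
  fun x u v => g (f x) (differential f u) (differential f v).

Definition normal_vector (R : realType) (m n : nat)
    (M : manifold R m) (N : manifold R n) (f : M -> N)
    (g : N -> tvec N -> tvec N -> R) (x : M) (u : tvec N) : Prop :=
  tangent (f x) u /\
  forall v, tangent x v -> g (f x) u (differential f v) = 0.

(* JX = TX + NX *)
Definition tangent_normal_parts (R : realType) (m n : nat)
    (M : manifold R m) (Mbar : manifold R n) (f : M -> Mbar)
    (g : Mbar -> tvec Mbar -> tvec Mbar -> R)
    (J : Mbar -> tvec Mbar -> tvec Mbar)
    (T : M -> tvec M -> tvec M) (N : M -> tvec M -> tvec Mbar) : Prop :=
  forall x v, tangent x v ->
    [/\ tangent x (T x v),
        normal_vector f g x (N x v)
      & J (f x) (differential f v) = differential f (T x v) + N x v].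

Definition cov_deriv_endo (R : realType) (n : nat) (M : manifold R n)
    (nabla : (M -> tvec M) -> (M -> tvec M) -> (M -> tvec M))
    (T : M -> tvec M -> tvec M) (X Y : M -> tvec M) : M -> tvec M :=
  fun x => nabla X (fun y => T y (Y y)) x - T x (nabla X Y x).

Definition local_frame (R : realType) (n : nat) (M : manifold R n)
    (D : M -> set (tvec M)) (r : nat) (U : set M)
    (E : 'I_r -> M -> tvec M) : Prop :=
  [/\ forall i, smooth_field_on U (E i),
      forall x, U x ->
        D x = [set v | exists a : 'I_r -> R, v = \sum_(i < r) a i *: E i x]
    & forall x, U x -> forall a : 'I_r -> R,
        \sum_(i < r) a i *: E i x = 0 -> forall i, a i = 0].

Definition smooth_distribution (R : realType) (n : nat) (M : manifold R n)
    (D : M -> set (tvec M)) : Prop :=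
  exists r : nat, forall x, exists U (E : 'I_r -> M -> tvec M),
    [/\ open U, U x & local_frame D U E].

Definition section (R : realType) (n : nat) (M : manifold R n)
    (D : M -> set (tvec M)) (X : M -> tvec M) : Prop :=
  smooth_field X /\ forall x, D x (X x).

Definition integrable_distribution (R : realType) (n : nat)
    (M : manifold R n) (D : M -> set (tvec M)) : Prop :=
  forall X Y, section D X -> section D Y -> section D (lie_bracket X Y).

Definition vector_angle (R : realType) (n : nat) (M : manifold R n)
    (g : M -> tvec M -> tvec M -> R) (x : M) (u v : tvec M) : R :=
  acos (g x u v / (Num.sqrt (g x u u) * Num.sqrt (g x v v))).

(* Least angle between u and a nonzero vector of the subspace W; it is the
   angle between u and its orthogonal projection on W when the latter is not
   0, and pi / 2 when u is orthogonal to W. *)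
Definition subspace_angle (R : realType) (n : nat) (M : manifold R n)
    (g : M -> tvec M -> tvec M -> R) (x : M) (u : tvec M)
    (W : set (tvec M)) : R :=
  inf [set vector_angle g x u w | w in [set w | W w /\ w <> 0]].

Definition slant (R : realType) (m n : nat)
    (M : manifold R m) (Mbar : manifold R n) (f : M -> Mbar)
    (g : Mbar -> tvec Mbar -> tvec Mbar -> R)
    (J : Mbar -> tvec Mbar -> tvec Mbar)
    (D : M -> set (tvec M)) (theta : R) : Prop :=
  forall x v, D x v -> v <> 0 ->
    subspace_angle g (f x) (J (f x) (differential f v))
      (differential f @` D x) = theta.

Record hemi_slant (R : realType) (m n : nat)
    (M : manifold R m) (Mbar : manifold R n) (f : M -> Mbar)
    (g : Mbar -> tvec Mbar -> tvec Mbar -> R)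
    (J : Mbar -> tvec Mbar -> tvec Mbar)
    (Dtheta Dperp : M -> set (tvec M)) (theta : R) : Prop := HemiSlant {
  hemi_slant_distr_theta : smooth_distribution Dtheta;
  hemi_slant_distr_perp : smooth_distribution Dperp;
  hemi_slant_orthogonal : forall x u v, Dtheta x u -> Dperp x v ->
    induced_metric f g x u v = 0;
  hemi_slant_sum : forall x v, tangent x v ->
    exists u w, [/\ Dtheta x u, Dperp x w & v = u + w];
  hemi_slant_angle : 0 <= theta <= pi / 2;
  hemi_slant_slant : slant f g J Dtheta theta;
  hemi_slant_anti_invariant : forall x v, Dperp x v ->
    normal_vector f g x (J (f x) (differential f v))
}.

(* Main.v *)
(* As J maps Dperp into the normal bundle, T vanishes on Dperp, so for sections
   Z, W of Dperp the torsion-free identity gives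
   (nabla_Z T) W - (nabla_W T) Z = - T [Z, W].  It remains to see that
   Dperp = ker T.  If T v = 0 and u is the Dtheta-component of v, then T u = 0,
   i.e. J u is normal; if u were not 0, the slant angle would be pi / 2.
   Linearity of T rests on differentials mapping derivations to derivations,
   hence on the chain rule for C^k maps. *)
Require Import Defs.
From HB Require Import structures.
From mathcomp Require Import all_boot all_order all_algebra.
From mathcomp Require Import all_classical all_reals all_analysis.
From mathcomp Require Import ring.
Import Order.TTheory GRing.Theory Num.Theory numFieldNormedType.Exports.

Set Implicit Arguments.
Unset Strict Implicit.
Unset Printing Implicit Defensive.

Local Open Scope classical_set_scope.
Local Open Scope ring_scope.

(** * Calculus of [C^k] maps on open sets of normed spaces *)

Lemma near_eq_differentiable (R : numFieldType) (V W : normedModType R)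
    (f g : V -> W) (x : V) :
  {near x, f =1 g} -> differentiable g x -> differentiable f x.
Proof.
move=> fg dg.
(* The first-order expansion of [g] at [x] is also one of [f]; uniqueness of the differential then
   identifies ['d f x] with ['d g x]. *)
have fE : f \o shift x = cst (f x) + 'd g x +o_ 0 id.
  apply/eqaddoP => e e0.
  have /eqaddoP/(_ e e0) dge := diff_locally dg.
  have fgx : \forall h \near (0 : V), f (h + x) = g (h + x).
    by have := fg; rewrite (near_shift 0 x) subr0.
  near=> h; rewrite /= /GRing.add /= /cst /=.
  have -> : f x = g x by exact: nbhs_singleton fg.
  by rewrite (near fgx h) //; near: h; exact: dge.
have dfE := diff_unique (diff_continuous dg) fE.
by apply/diff_locallyP; rewrite dfE; split=> //; exact: diff_continuous.
Unshelve. all: by end_near. Qed.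

Section CkTheory.
Context {R : realType}.
Implicit Types V W : normedModType R.

(** Continuity, differentiability and directional derivatives at a point depend only on the germ
    there. The local model [g] may change with [x], as is needed when the chart changes from point
    to point. *)
Lemma Ck_on_local V W k (U : set V) (f : V -> W) :
  (forall x, U x -> exists A g,
    [/\ open A, A x, Ck_on k A g & forall y, A y -> f y = g y]) ->
  Ck_on k U f.
Proof.
have near_A (A : set V) x (g h : V -> W) : open A -> A x ->
    (forall y, A y -> g y = h y) -> {near x, g =1 h}.
  by move=> Ao Ax gh; apply: filterS gh _; exact: open_nbhs_nbhs.
elim: k f => [|k IH] f H.
  move=> x /H [A [g [Ao Ax gA fg]]].
  have nfg := near_A _ _ _ _ Ao Ax fg.
  rewrite /continuous_at (fg _ Ax).
  by apply: cvg_trans (gA _ Ax); apply: near_eq_cvg; near do apply/esym.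
split=> [x /H [A [g [Ao Ax [gd _] fg]]]|v].
  exact: near_eq_differentiable (near_A _ _ _ _ Ao Ax fg) (gd _ Ax).
apply: IH => x /H [A [g [Ao Ax [_ gD] fg]]].
exists A, ('D_v g); split=> //; first exact: gD.
move=> y Ay.
by apply: near_eq_derive; exact: near_A Ao Ay fg.
Unshelve. all: by end_near. Qed.

Lemma Ck_on_eq V W k (U : set V) (f g : V -> W) : open U ->
  (forall x, U x -> f x = g x) -> Ck_on k U g -> Ck_on k U f.
Proof. by move=> Uo fg gU; apply: Ck_on_local => x Ux; exists U, g. Qed.

Lemma Ck_onW V W k (U : set V) (f : V -> W) : Ck_on k.+1 U f -> Ck_on k U f.
Proof.
elim: k f => [|k IH] f [fd fD].
  by move=> x /fd; exact: differentiable_continuous.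
by split=> // v; exact/IH/fD.
Qed.

Lemma Ck_on_cst V W k (U : set V) (a : W) : Ck_on k U (fun=> a).
Proof.
elim: k a => [|k IH] a; first by move=> x _; exact: cst_continuous.
split=> [x _|v]; first exact: differentiable_cst.
have -> : 'D_v (fun=> a) = (fun=> 0) :> (V -> W).
  by apply/funext => x; exact: derive_cst.
exact: IH.
Qed.

Lemma Ck_onD V W k (U : set V) (f g : V -> W) : open U ->
  Ck_on k U f -> Ck_on k U g -> Ck_on k U (fun x => f x + g x).
Proof.
move=> Uo; elim: k f g => [|k IH] f g.
  by move=> fU gU x Ux; apply: cvgD; [exact: fU|exact: gU].
move=> [fd fD] [gd gD]; split=> [x Ux|v].
  by apply: differentiableD; [exact: fd|exact: gd].
apply: (Ck_on_eq Uo _ (IH _ _ (fD v) (gD v))) => x Ux.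
by apply: deriveD; apply: diff_derivable; [exact: fd|exact: gd].
Qed.

Lemma Ck_onM V k (U : set V) (f g : V -> R^o) : open U ->
  Ck_on k U f -> Ck_on k U g -> Ck_on k U (fun x => f x * g x : R^o).
Proof.
move=> Uo; elim: k f g => [|k IH] f g.
  by move=> fU gU x Ux; apply: cvgM; [exact: fU|exact: gU].
move=> fU gU; have [fd fD] := fU; have [gd gD] := gU; split=> [x Ux|v].
  by apply: differentiableM; [exact: fd|exact: gd].
(* The Leibniz rule pairs each factor with the derivative of the other, so the undifferentiated
   factor is lowered by one order to fit the induction. *)
have fDg := IH _ _ (Ck_onW fU) (gD v).
have gDf := IH _ _ (Ck_onW gU) (fD v).
apply: (Ck_on_eq Uo _ (Ck_onD Uo fDg gDf)) => x Ux.
by apply: deriveM; apply: diff_derivable; [exact: fd|exact: gd].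
Qed.

Lemma Ck_on_sum V W k (U : set V) r (f : 'I_r -> V -> W) : open U ->
  (forall i, Ck_on k U (f i)) -> Ck_on k U (fun x => \sum_(i < r) f i x).
Proof.
move=> Uo; elim: r f => [|r IH] f fU.
  apply: (Ck_on_eq Uo _ (Ck_on_cst k U (0 : W))) => x _.
  by rewrite big_ord0.
pose g x := \sum_(i < r) f (widen_ord (leqnSn r) i) x.
apply: (Ck_on_eq (g := fun x => g x + f ord_max x) Uo).
  by move=> x _; rewrite big_ord_recr.
by apply: Ck_onD => //; apply: IH.
Qed.

(** A coordinate is a continuous linear form, so it commutes with ['D_v]. *)
Lemma Ck_on_coord V n k (U : set V) (f : V -> 'rV[R]_n) (i : 'I_n) : open U ->
  Ck_on k U f -> Ck_on k U (fun x => f x 0 i : R^o).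
Proof.
move=> Uo; elim: k f => [|k IH] f.
  move=> fU x Ux.
  apply: (@continuous_comp _ _ _ f (fun u : 'rV[R]_n => u 0 i : R^o) x).
    exact: fU.
  exact: coord_continuous.
pose c (u : 'rV[R]_n) : R^o := u 0 i.
have c_lin : linear c by move=> a u v; rewrite /c !mxE.
pose cL : {linear 'rV[R]_n -> R^o} :=
  HB.pack c (GRing.isLinear.Build _ _ _ _ _ c_lin).
have cc : continuous cL by exact: (@coord_continuous R 1 n 0 i).
move=> [fd fD]; have cd x : U x -> differentiable (cL \o f) x.
  by move=> /fd df; apply: differentiable_comp => //;
    exact: linear_differentiable.
split=> // v; apply: (Ck_on_eq Uo _ (IH _ (fD v))) => x Ux.
rewrite -[LHS]/('D_v (cL \o f) x) !deriveE; [|exact: fd|exact: cd].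
rewrite diff_comp; [|exact: fd|exact: linear_differentiable].
by rewrite [LHS]/= (@diff_lin _ _ _ cL).
Qed.

(** By the chain rule in the standard basis, ['D_v (g \o f)] is the sum of the coordinates of
    ['D_v f] times the partial derivatives of [g] along [f]; these are handled by induction on [k],
    with [f] lowered by one order. *)
Lemma Ck_on_comp V n k (U : set V) (A : set 'rV[R]_n) (f : V -> 'rV[R]_n)
    (g : 'rV[R]_n -> R^o) : open U -> (forall x, U x -> A (f x)) ->
  Ck_on k U f -> Ck_on k A g -> Ck_on k U (g \o f).
Proof.
move=> Uo UA; elim: k g => [|k IH] g fU gA.
  by move=> x Ux; apply: (@continuous_comp _ _ _ f g x (fU x Ux)); exact/gA/UA.
have [fd fD] := fU; have [gd gD] := gA.
split=> [x Ux|v].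
  by apply: differentiable_comp; [exact: fd|exact/gd/UA].
pose e i : 'rV[R]_n := delta_mx 0 i.
pose Dgf x := \sum_(i < n) ('D_v f x) 0 i * 'D_(e i) g (f x).
apply: (Ck_on_eq (g := Dgf) Uo).
  move=> x Ux; have dg := gd _ (UA _ Ux); have df := fd _ Ux.
  rewrite [LHS]deriveE; last exact: differentiable_comp.
  rewrite diff_comp //= [X in 'd g _ X]row_sum_delta linear_sum.
  by apply: eq_bigr => i _; rewrite linearZ !deriveE.
apply: Ck_on_sum => // i; apply: Ck_onM => //.
  exact: (Ck_on_coord i Uo (fD v)).
exact: (IH _ (Ck_onW fU) (gD (e i))).
Qed.

End CkTheory.

(** * Smooth functions, tangent vectors and differentials *)

Section Smooth.
Context {R : realType}.

(** On the open set [chart_cod c], continuity within the subspace is ordinary continuity. *)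
Lemma open_chart_preimage n (M : manifold R n) (c : chart R n M) (U : set M) :
  open U -> open (chart_cod c `&` chart_inv c @^-1` U).
Proof.
move=> Uo; rewrite openE => x [cx Ux].
have := @chart_inv_continuous _ _ _ c.
rewrite continuous_open_subspace; last exact: chart_cod_open.
move=> /(_ x); rewrite inE => /(_ cx) ci.
apply: filterI.
  by apply: open_nbhs_nbhs; split=> //; exact: chart_cod_open.
by apply: ci; exact: open_nbhs_nbhs.
Qed.

Lemma smooth_onD n (M : manifold R n) (U : set M) (h k : M -> R) : open U ->
  smooth_on U h -> smooth_on U k -> smooth_on U (fun x => h x + k x).
Proof.
move=> Uo hU kU c ac r; apply: Ck_onD; first exact: open_chart_preimage.
  exact: hU.
exact: kU.
Qed.

Lemma smooth_onM n (M : manifold R n) (U : set M) (h k : M -> R) : open U ->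
  smooth_on U h -> smooth_on U k -> smooth_on U (fun x => h x * k x).
Proof.
move=> Uo hU kU c ac r; apply: Ck_onM; first exact: open_chart_preimage.
  exact: hU.
exact: kU.
Qed.

Lemma smooth_on_cst n (M : manifold R n) (U : set M) (a : R) :
  smooth_on U (fun=> a).
Proof. by move=> c ac r; exact: Ck_on_cst. Qed.

(** Around each point, a chart [d] at the image factors [h \o f] read in [c] as ([h] read in [d])
    after ([f] read in [c] and [d]). *)
Lemma smooth_fun_comp m n (M : manifold R m) (N : manifold R n) (f : M -> N)
    (h : N -> R) : smooth_map f -> smooth_fun h -> smooth_fun (h \o f).
Proof.
move=> [fc fS] hS c ac k; apply: Ck_on_local => x [cx _].
have [d ad dx] := atlas_cover (f (chart_inv c x)).
exists (chart_cod c `&` chart_inv c @^-1` (f @^-1` chart_dom d)).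
exists ((h \o chart_inv d) \o (chart_map d \o f \o chart_inv c)).
have Ao : open (chart_cod c `&` chart_inv c @^-1` (f @^-1` chart_dom d)).
  apply: open_chart_preimage; apply: open_comp; first by move=> y _; exact: fc.
  exact: chart_dom_open.
split=> //.
  apply: (Ck_on_comp Ao _ (fS _ _ ac ad k) (hS _ ad k)) => y [_ dy].
  by split=> //; exact: chart_map_cod.
by move=> y [_ dy]; rewrite /= chart_mapK.
Qed.

Lemma tangent_linear n (M : manifold R n) (x : M) (a : R) (u v : tvec M) :
  tangent x u -> tangent x v -> tangent x (a *: u + v).
Proof.
move=> [uD uZ uM u0] [vD vZ vM v0].
have E h : (a *: u + v) h = a * u h + v h by [].
split=> [h k hS kS|b h hS|h k hS kS|h hS]; rewrite !E.
- by rewrite uD // vD // mulrDr addrACA.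
- by rewrite uZ // vZ // mulrDr !mulrA [a * b]mulrC.
- by rewrite uM // vM //; ring.
- by rewrite u0 // v0 // mulr0 addr0.
Qed.

Lemma tangent0 n (M : manifold R n) (x : M) : tangent x (0 : tvec M).
Proof.
have E h : (0 : tvec M) h = 0 by [].
split=> [h k hS kS|b h hS|h k hS kS|h hS]; rewrite !E //.
- by rewrite addr0.
- by rewrite mulr0.
- by rewrite mul0r mulr0 addr0.
Qed.

Lemma tangent_sum n (M : manifold R n) (x : M) r (a : 'I_r -> R)
    (E : 'I_r -> tvec M) :
  (forall i, tangent x (E i)) -> tangent x (\sum_(i < r) a i *: E i).
Proof.
move=> ET; elim/big_ind: _ => [|u v uT vT|i _]; first exact: tangent0.
  by rewrite -[u]scale1r; exact: tangent_linear.
by rewrite -[_ *: _]addr0; apply: tangent_linear => //; exact: tangent0.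
Qed.

Lemma tangentB n (M : manifold R n) (x : M) (u v : tvec M) :
  tangent x u -> tangent x v -> tangent x (u - v).
Proof. by move=> uT vT; rewrite addrC -scaleN1r; exact: tangent_linear. Qed.

Lemma distribution_tangent n (M : manifold R n) (D : M -> set (tvec M)) x v :
  smooth_distribution D -> D x v -> tangent x v.
Proof.
move=> [r /(_ x)[U [E [_ Ux [ES DE _]]]]]; rewrite DE // => -[a ->].
by apply: tangent_sum => i; have [+ _] := ES i; apply.
Qed.

Lemma differential_linear m n (M : manifold R m) (N : manifold R n)
    (f : M -> N) (a : R) (u v : tvec M) :
  differential f (a *: u + v) = a *: differential f u + differential f v.
Proof.
apply/funext => h; rewrite /differential /=.
change ((if `[< smooth_fun h >] then a * u (h \o f) + v (h \o f) else 0) =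
  a * (if `[< smooth_fun h >] then u (h \o f) else 0) +
  (if `[< smooth_fun h >] then v (h \o f) else 0) :> R).
by case: ifP => // _; rewrite mulr0 addr0.
Qed.

Lemma differentialB m n (M : manifold R m) (N : manifold R n)
    (f : M -> N) (u v : tvec M) :
  differential f (u - v) = differential f u - differential f v.
Proof. by rewrite addrC -scaleN1r differential_linear scaleN1r addrC. Qed.

Lemma differential0 m n (M : manifold R m) (N : manifold R n)
    (f : M -> N) : differential f (0 : tvec M) = 0.
Proof. by rewrite -[0 in LHS](subrr 0) differentialB subrr. Qed.

(** Pulling back along [f] is an algebra map on smooth functions, so it turns derivations at [x]
    into derivations at [f x]. *)
Lemma differential_tangent m n (M : manifold R m) (N : manifold R n)
    (f : M -> N) (x : M) (v : tvec M) :
  smooth_map f -> tangent x v -> tangent (f x) (differential f v).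
Proof.
move=> fS [vD vZ vM v0].
have E h : smooth_fun h -> differential f v h = v (h \o f).
  by move=> hS; rewrite /differential asboolT.
have fC h : smooth_fun h -> smooth_fun (h \o f) by exact: smooth_fun_comp.
have oT : open [set: N] by exact: openT.
split=> [h k hS kS|b h hS|h k hS kS|h hS].
- by rewrite !E //; [exact: vD (fC _ hS) (fC _ kS)|exact: smooth_onD].
- rewrite !E //; first exact: vZ (fC _ hS).
  by apply: smooth_onM => //; exact: smooth_on_cst.
- by rewrite !E //; [exact: vM (fC _ hS) (fC _ kS)|exact: smooth_onM].
- by rewrite /differential asboolF.
Qed.

Lemma smooth_field0 n (M : manifold R n) :
  smooth_field (fun _ : M => 0 : tvec M).
Proof.
split=> [x _|h hS]; first exact: tangent0.
exact: smooth_on_cst.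
Qed.

Lemma smooth_fieldB n (M : manifold R n) (X Y : M -> tvec M) :
  smooth_field X -> smooth_field Y -> smooth_field (fun x => X x - Y x).
Proof.
move=> [XT XS] [YT YS]; split=> [x xT|h hS].
  by apply: tangentB; [exact: XT|exact: YT].
have -> : (fun x => (X x - Y x) h) = fun x => X x h + -1 * Y x h.
  by apply/funext => x; rewrite mulN1r.
have oT : open [set: M] by exact: openT.
apply: smooth_onD => //; first exact: XS.
by apply: smooth_onM => //; [exact: smooth_on_cst|exact: YS].
Qed.

Lemma connection0r n (M : manifold R n) nabla (X : M -> tvec M) :
  connection nabla -> smooth_field X -> nabla X (fun=> 0) = fun=> 0.
Proof.
move=> nC XS; have S0 := @smooth_field0 n M.
have := connectionDr nC XS S0 S0.
have -> : (fun _ : M => 0 + 0 : tvec M) = fun=> 0.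
  by apply/funext => x; rewrite addr0.
move=> H; apply/funext => x; move/(congr1 (fun F => F x)): H => /=.
by move/esym/eqP; rewrite addrC -subr_eq0 addrK => /eqP.
Qed.

End Smooth.

(** * Tangent and normal parts of [J] along the immersion *)

Section HemiSlant.
Context {R : realType} {m n : nat} {M : manifold R m} {Mbar : manifold R n}.
Context {p q : nat} {gbar : Mbar -> tvec Mbar -> tvec Mbar -> R}.
Context {J : Mbar -> tvec Mbar -> tvec Mbar} {f : M -> Mbar}.
Context {T : M -> tvec M -> tvec M} {N : M -> tvec M -> tvec Mbar}.
Hypothesis mJ : metallic p q gbar J.
Hypothesis imf : immersion f.
Hypothesis TN : tangent_normal_parts f gbar J T N.

Local Notation df := (differential f).
Local Notation normal := (normal_vector f gbar).

Lemma normalB x u v : normal x u -> normal x v -> normal x (u - v).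
Proof.
move=> [uT un] [vT vn]; split=> [|w wT]; first exact: tangentB.
have dw := differential_tangent imf.1 wT.
rewrite addrC -scaleN1r (metric_linear (metallic_metric mJ)) //.
by rewrite un // vn // mulr0 addr0.
Qed.

(** Such a [df v] is orthogonal to itself, hence zero, and [df] is injective on tangent vectors. *)
Lemma tangent_normal0 x v : tangent x v -> normal x (df v) -> v = 0.
Proof.
move=> vT [dvT vn]; apply: (imf.2 _ _ vT).
have [//|/eqP dv0] := eqVneq (df v) 0.
by have := metric_gt0 (metallic_metric mJ) dvT dv0; rewrite vn // ltxx.
Qed.

Lemma tangent_part_normal x v :
  tangent x v -> normal x (J (f x) (df v)) -> T x v = 0.
Proof.
move=> vT Jn; have [TvT Nn JE] := TN vT.
apply: (@tangent_normal0 x) => //.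
have -> : df (T x v) = J (f x) (df v) - N x v by rewrite JE addrK.
exact: normalB.
Qed.

Lemma J_linear x (a : R) u v : tangent x u -> tangent x v ->
  J (f x) (df (a *: u + v)) = a *: J (f x) (df u) + J (f x) (df v).
Proof.
move=> uT vT; rewrite differential_linear (metallic_linear mJ) //.
  exact: differential_tangent imf.1 uT.
exact: differential_tangent imf.1 vT.
Qed.

(** [T] is given only through the decomposition of [J]; its additivity comes from uniqueness of that
    decomposition, since the defect is both tangent and normal. *)
Lemma tangent_partB x u v : tangent x u -> tangent x v ->
  T x (u - v) = T x u - T x v.
Proof.
move=> uT vT; have uvT := tangentB uT vT.
have [TuT Nu Ju] := TN uT; have [TvT Nv Jv] := TN vT.
have [TuvT Nuv Juv] := TN uvT.
apply/eqP; rewrite -subr_eq0; apply/eqP; apply: (@tangent_normal0 x).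
  by apply: tangentB => //; exact: tangentB.
have -> : df (T x (u - v) - (T x u - T x v)) = (N x u - N x v) - N x (u - v).
  have : J (f x) (df (u - v)) = J (f x) (df u) - J (f x) (df v).
    by rewrite addrC -scaleN1r J_linear // scaleN1r addrC.
  rewrite Juv Ju Jv opprD addrACA => /(canRL (addrK _)) E.
  rewrite !differentialB E.
  by rewrite [LHS]addrAC; congr (_ - _); rewrite [LHS]addrC addKr.
by apply: normalB => //; exact: normalB.
Qed.

Lemma normal_angle D x u : D x u -> u <> 0 ->
  (forall v, D x v -> tangent x v) ->
  normal x (J (f x) (df u)) ->
  subspace_angle gbar (f x) (J (f x) (df u)) (df @` D x) = pi / 2.
Proof.
move=> Du u0 DT [_ Jn]; rewrite /subspace_angle.
rewrite (_ : [set _ | _ in _] = [set pi / 2]) ?inf1 //.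
apply/seteqP; split=> [_ [w [[v Dv <-] _] <-]|_ ->] /=.
  by rewrite /vector_angle Jn ?mul0r ?acos0 //; exact: DT.
(* The nonzero vector [df u] shows that the set of angles is inhabited; the infimum of an empty set
   would be the default value 0. *)
exists (df u); last by rewrite /vector_angle Jn ?mul0r ?acos0 //; exact: DT.
by split; [exists u|move=> du0; apply: u0; exact: imf.2 (DT _ Du) du0].
Qed.

End HemiSlant.

(** * Integrability of the anti-invariant distribution *)

Theorem proposition12 (R : realType) (m n p q : nat)
    (M : manifold R m) (Mbar : manifold R n)
    (gbar : Mbar -> tvec Mbar -> tvec Mbar -> R)
    (J : Mbar -> tvec Mbar -> tvec Mbar)
    (nablabar : (Mbar -> tvec Mbar) -> (Mbar -> tvec Mbar) ->
                (Mbar -> tvec Mbar))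
    (f : M -> Mbar)
    (nabla : (M -> tvec M) -> (M -> tvec M) -> (M -> tvec M))
    (T : M -> tvec M -> tvec M) (N : M -> tvec M -> tvec Mbar)
    (Dtheta Dperp : M -> set (tvec M)) (theta : R) :
  (0 < p)%N -> (0 < q)%N ->
  metallic p q gbar J ->
  levi_civita gbar nablabar ->
  parallel nablabar J ->
  (m < n)%N ->
  immersion f ->
  levi_civita (induced_metric f gbar) nabla ->
  tangent_normal_parts f gbar J T N ->
  hemi_slant f gbar J Dtheta Dperp theta ->
  (* If theta = pi / 2, then T = 0 and the equivalence fails: in the flat R^6
     with a parallel metallic J, a linear anti-invariant M = R^3 is hemi-slant
     for Dperp = a contact distribution and Dtheta = its orthogonal. *)
  theta <> pi / 2 ->
  (integrable_distribution Dperp <->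
  forall Z W, section Dperp Z -> section Dperp W ->
     cov_deriv_endo nabla T Z W = cov_deriv_endo nabla T W Z).
Proof.
move=> _ _ mJ _ _ _ imf nLC TN HS thN.
have nC := levi_civita_connection nLC.
have DpT x v : Dperp x v -> tangent x v.
  exact: distribution_tangent (hemi_slant_distr_perp HS).
have DtT x v : Dtheta x v -> tangent x v.
  exact: distribution_tangent (hemi_slant_distr_theta HS).
have Tperp x v : Dperp x v -> T x v = 0.
  move=> Dv; apply: (tangent_part_normal mJ imf TN (DpT _ _ Dv)).
  exact: hemi_slant_anti_invariant HS _ _ Dv.
have Ttheta x u : Dtheta x u -> T x u = 0 -> u = 0.
  move=> Du Tu; have [//|/eqP u0] := eqVneq u 0; case: thN.
  (* A nonzero [u] computes [theta] as the angle between [J u] and [Dtheta], which is [pi / 2]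
     because [J u = N u] is normal. *)
  rewrite -(hemi_slant_slant HS Du u0).
  apply: (normal_angle imf) => //; first exact: DtT.
  have [_ Nn ->] := TN _ _ (DtT _ _ Du).
  by rewrite Tu differential0 add0r.
have kerT x v : tangent x v -> T x v = 0 -> Dperp x v.
  move=> vT; have [u [w [Du Dw vE]]] := hemi_slant_sum HS vT => Tv.
  suff u0 : u = 0 by rewrite vE u0 add0r.
  have -> : u = v - w by rewrite vE addrK.
  (* [T] kills both [v] and [w], hence also the [Dtheta]-component [v - w]. *)
  rewrite (Ttheta x (v - w)) //; first by rewrite vE addrK.
  by rewrite (tangent_partB mJ imf TN) //;
    [rewrite Tv Tperp // subrr|exact: DpT].
(* The term [nabla Z (T W)] is the derivative of the zero field. *)
have covE Z W : section Dperp Z -> section Dperp W ->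
    cov_deriv_endo nabla T Z W = fun x => - T x (nabla Z W x).
  move=> [ZS ZD] [WS WD]; rewrite /cov_deriv_endo.
  have -> : (fun y => T y (W y)) = fun=> 0 by apply/funext => y; exact: Tperp.
  by rewrite connection0r //; apply/funext => x; rewrite sub0r.
have bracketE Z W : section Dperp Z -> section Dperp W ->
    forall x, T x (lie_bracket Z W x) = T x (nabla Z W x) - T x (nabla W Z x).
  move=> [ZS _] [WS _] x; rewrite -(levi_civita_torsion_free nLC) //.
  by apply: (tangent_partB mJ imf TN); apply: (connection_smooth nC _ _).1.
split=> [Dint Z W ZD WD|H Z W ZD WD].
  rewrite !covE //; apply/funext => x; congr (- _); apply/eqP.
  by rewrite -subr_eq0 -bracketE // Tperp //; exact: (Dint _ _ ZD WD).2.
(* Being torsion-free, [nabla] presents the bracket as a difference of smooth fields, which gives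
   both its smoothness and the tangency required by [kerT]. *)
have bS : smooth_field (lie_bracket Z W).
  rewrite -(levi_civita_torsion_free nLC ZD.1 WD.1).
  by apply: smooth_fieldB; apply: (connection_smooth nC) => //;
    [exact: ZD.1|exact: WD.1|exact: WD.1|exact: ZD.1].
split=> // x; apply: kerT; first exact: bS.1.
(* At [x], the hypothesis equates the opposites of the two terms of [T [Z, W]]. *)
rewrite bracketE //; apply/eqP; rewrite subr_eq0; apply/eqP/oppr_inj.
by have := H _ _ ZD WD; rewrite !covE // => /(congr1 (fun F => F x)).
Qed.
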